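(* Let $q$ be a prime power, $m\ge1$, and $b_0,\dots,b_{m-1},c_0,\dots,c_{m-1}\in\mathbb F_{q^m}$. For $a,b\in\mathbb F_{q^m}$ define $g_{(a,b)}(t)=a^2t+\sum_{i=0}^{m-1}(b_iab+c_ib^2)^{1/q^i}t^{1/q^i}$ and $h_{(a,b)}(r,s)=2ar+\sum_{i=0}^{m-1}(b_i(as+br)+2c_ibs)^{1/q^i}$, and in ${\rm PG}(4m-1,q)$ the subspaces $E(a,b)=\{(t,-g_{(a,b)}(t),-at,-bt)_q:t\in\mathbb F_{q^m}\}$, $E_\infty=\{(0,t,0,0)_q:t\in\mathbb F_{q^m}\}$, $E^*(a,b)=\{(t,h_{(a,b)}(r,s)+g_{(a,b)}(t),r,s)_q:t,r,s\in\mathbb F_{q^m}\}$, $E^*_\infty=\{(0,t,r,s)_q:t,r,s\in\mathbb F_{q^m}\}$. Assume that $\mathcal E=\{E(a,b):a,b\in\mathbb F_{q^m}\}\cup\{E_\infty\}$ is an egg of ${\rm PG}(4m-1,q)$ which is good at $E_\infty$, with tangent spaces $E^*(a,b)$ at $E(a,b)$ and $E^*_\infty$ at $E_\infty$. Let $\Gamma'=\{(u,t,r,s)_q:u\in\mathbb F_q,\ t,r,s\in\mathbb F_{q^m}\}$ (a $3m$-dimensional subspace containing $E^*_\infty$), $\mathcal B_{\mathcal E}=\{E\cap\Gamma':E\in\mathcal E,E\ne E_\infty\}$, $\mathcal I_{\mathcal E}=\{E^*(a,b)\cap E^*_\infty: a,b\in\mathbb F_{q^m}\}$, and $\mathcal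 F_{\mathcal E}$ the family of all $2m$-dimensional subspaces of $\Gamma'$ not contained in $E^*_\infty$ that contain an element of $\mathcal I_{\mathcal E}$. Then $\mathcal B_{\mathcal E}$ is a minimal $\mathcal F_{\mathcal E}$-blocking set if and only if for every $c\in\mathbb F_{q^m}$ the equation $X^2+\sum_{i=0}^{m-1}(b_iXY+c_iY^2)^{1/q^i}+c=0$ has a solution $(X,Y)\in\mathbb F_{q^m}^2$.
   Context: Fix a basis of $\mathbb F_{q^m}$ over $\mathbb F_q$; for $(x_1,\dots,x_r)\in\mathbb F_{q^m}^r$, $(x_1,\dots,x_r)_q\in\mathbb F_q^{rm}$ denotes its coordinate vector, and ${\rm PG}(4m-1,q)$ is the projective space of $\mathbb F_q^{4m}$; a set of the form $\{(\dots)_q\}$ which is an $\mathbb F_q$-subspace is identified with the corresponding projective subspace. Here $z^{1/q^i}$ means $z^{q^{m-i}}$, and $\mathbb F_q\subseteq\mathbb F_{q^m}$. An egg in ${\rm PG}(4m-1,q)$ is a set of $q^{2m}+1$ pairwise disjoint $(m-1)$-dimensional subspaces any three of which span a $(3m-1)$-dimensional subspace; the tangent space at an element $E$ is the unique $(3m-1)$-dimensional subspace containing $E$ and disjoint from all other elements. An egg is good at an element $E$ if every $(3m-1)$-dimensional subspace containing $E$ and at least two other egg elements contains exactly $q^m+1$ egg elements. A minimal $\mathcal F_{\mathcal E}$-blocking set is a set of points of $\Gamma'\setminus E^*_\infty$ meeting every element of $\mathcal F_{\mathcal E}$ such that through each of its points $P$ some element of $\mathcal F_{\mathcal E}$ meets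 it only in $P$. *)

(* Defs.v *)
From HB Require Import structures.
From mathcomp Require Import all_boot all_order all_algebra all_field.
From mathcomp Require Import boolp classical_sets functions cardinality.

Set Implicit Arguments.
Unset Strict Implicit.
Unset Printing Implicit Defensive.

Import GRing.Theory.
Local Open Scope classical_set_scope.
Local Open Scope card_scope.
Local Open Scope ring_scope.

(* PG(n-1, q) is the lattice of subspaces {vspace 'rV[F]_n} with q = #|F|; all
   dimensions below are vector-space dimensions, i.e. one more than the
   projective ones.  Projectively disjoint means intersecting in 0. *)

(* The subspace identified with a set of vectors A: its linear span, which is A
   itself as soon as A is closed under linear combinations (in_subspace_of). *)
Definition subspace_of (F : finFieldType) (n : nat) (A : set 'rV[F]_n) :
    {vspace 'rV[F]_n} :=
  <<[seq v <- enum 'rV[F]_n | `[< A v >]]>>%VS.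

Lemma in_subspace_of (F : finFieldType) (n : nat) (A : set 'rV[F]_n) :
    A 0 -> (forall (k : F) u v, A u -> A v -> A (k *: u + v)) ->
  forall v, v \in subspace_of A <-> A v.
Proof.
move=> A0 AZD v; split=> [vA|Av]; last first.
  by apply: memv_span; rewrite mem_filter mem_enum andbT; apply/asboolP.
rewrite /subspace_of in vA.
set s := [seq _ <- _ | _] in vA.
rewrite (coord_span (X := in_tuple s) vA).
elim/big_ind: _ => [//|x y Ax Ay|i _].
  by rewrite -[x]scale1r; exact: AZD.
rewrite -[_ *: _]addr0; apply: AZD => //.
have : (in_tuple s)`_i \in s by exact: mem_nth.
by rewrite mem_filter => /andP[/asboolP].
Qed.

Section Eggs.

Variables (F : finFieldType) (m : nat).
Local Notation V := 'rV[F]_(4 * m).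
Implicit Types (S : set {vspace V}) (E T U : {vspace V}).

Definition egg S : Prop :=
  [/\ S #= `I_(#|F| ^ (2 * m)).+1,
      forall E, S E -> \dim E = m,
      forall E1 E2, S E1 -> S E2 -> E1 <> E2 -> (E1 :&: E2 = 0)%VS
    & forall E1 E2 E3, S E1 -> S E2 -> S E3 ->
        E1 <> E2 -> E1 <> E3 -> E2 <> E3 -> \dim (E1 + E2 + E3) = (3 * m)%N].

Definition tangent_cond S E T : Prop :=
  [/\ \dim T = (3 * m)%N, (E <= T)%VS
    & forall E', S E' -> E' <> E -> (E' :&: T = 0)%VS].

Definition tangent_space_at S E T : Prop :=
  tangent_cond S E T /\ forall T', tangent_cond S E T' -> T' = T.

Definition good_at S E : Prop :=
  forall U, \dim U = (3 * m)%N -> (E <= U)%VS ->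
    (exists E1 E2, [/\ S E1, S E2, E1 <> E, E2 <> E & E1 <> E2] /\
                   (E1 <= U)%VS /\ (E2 <= U)%VS) ->
  [set E' | S E' /\ (E' <= U)%VS] #= `I_(#|F| ^ m).+1.

(* Points are 1-dimensional vector subspaces; B is a set of points of G \ H. *)
Definition minimal_blocking_set (G H : {vspace V}) (Fam B : set {vspace V}) :
    Prop :=
  [/\ forall P, B P -> [/\ \dim P = 1%N, (P <= G)%VS & ~ (P <= H)%VS],
      forall W, Fam W -> exists2 P, B P & (P <= W)%VS
    & forall P, B P -> exists W, [/\ Fam W, (P <= W)%VS
        & forall P', B P' -> (P' <= W)%VS -> P' = P]].

End Eggs.

Section GoodEgg.

Variables (F : finFieldType) (L : fieldExtType F) (m : nat) (e : m.-tuple L).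
Variables (bs cs : 'I_m -> L).
Local Notation V := 'rV[F]_(4 * m).

(* (x_1, ..., x_r)_q, coordinates being taken in the basis e of L over F. *)
Definition qvec (r : nat) (x : r.-tuple L) : 'rV[F]_(r * m) :=
  mxvec (\matrix_(k < r, j < m) coord e j (tnth x k)).

(* z^(1/q^i), which in GF(q^m) is z^(q^(m-i)) for i <= m. *)
Definition qroot (i : nat) (z : L) : L := z ^+ (#|F| ^ (m - i)).

Definition g_ (a b t : L) : L :=
  a ^+ 2 * t +
  \sum_(i < m) qroot i (bs i * a * b + cs i * b ^+ 2) * qroot i t.

Definition h_ (a b r s : L) : L :=
  2%:R * a * r +
  \sum_(i < m) qroot i (bs i * (a * s + b * r) + 2%:R * cs i * b * s).

Definition E_ (a b : L) : {vspace V} :=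
  subspace_of [set v | exists t : L,
    v = qvec [tuple t; - g_ a b t; - (a * t); - (b * t)]].

Definition E_inf : {vspace V} :=
  subspace_of [set v | exists t : L, v = qvec [tuple 0; t; 0; 0]].

Definition Estar (a b : L) : {vspace V} :=
  subspace_of [set v | exists t r s : L,
    v = qvec [tuple t; h_ a b r s + g_ a b t; r; s]].

Definition Estar_inf : {vspace V} :=
  subspace_of [set v | exists t r s : L, v = qvec [tuple 0; t; r; s]].

Definition eggE : set {vspace V} :=
  [set U | exists a b : L, U = E_ a b] `|` [set E_inf].

Definition Gamma' : {vspace V} :=
  subspace_of [set v | exists (u : F) (t r s : L),
    v = qvec [tuple u%:A; t; r; s]].

Definition blockB : set {vspace V} :=
  [set P | exists E, [/\ eggE E, E <> E_inf & P = (E :&: Gamma')%VS]].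

Definition famI : set {vspace V} :=
  [set U | exists a b : L, U = (Estar a b :&: Estar_inf)%VS].

Definition famF : set {vspace V} :=
  [set W | [/\ \dim W = (2 * m).+1, (W <= Gamma')%VS, ~ (W <= Estar_inf)%VS
    & exists2 U, famI U & (U <= W)%VS]].

End GoodEgg.

(* Main.v *)
Require Import Defs.
From HB Require Import structures.
From mathcomp Require Import all_boot all_order all_algebra all_field.
From mathcomp Require Import boolp classical_sets functions cardinality.
From mathcomp Require Import all_fingroup all_solvable ring.

Set Implicit Arguments.
Unset Strict Implicit.
Unset Printing Implicit Defensive.

Import GRing.Theory.
Local Open Scope ring_scope.

(* Put Q(a,b) = g_(a,b)(1).  The points of the blocking set are
   P(x,y) = <(1,-Q(x,y),-x,-y)>, and the members of the family are
   W(a,b,c) = <(1,c,0,0)> + {(0,h_(a,b)(r,s),r,s)}.  Since h is the polarization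
   of Q, P(x,y) lies in W(a,b,c) iff Q(a-x,b-y) + c - Q(a,b) = 0.  Hence being
   blocking means that Q + c always has a zero.  Minimality comes for free: the
   only zero of Q is (0,0), because E(a,b) is disjoint from the tangent space
   E*(0,0) unless (a,b) = (0,0), so W(x,y,Q(x,y)) contains only P(x,y). *)

Lemma mem_subspace_of (F : finFieldType) (n : nat) (A : set 'rV[F]_n) w :
    A w -> (forall (k : F) u v, A u -> A v -> A (k *: u + v)) ->
  forall v, v \in subspace_of A <-> A v.
Proof.
move=> Aw AZD; apply: in_subspace_of => //.
by have := AZD (-1) w w Aw Aw; rewrite scaleN1r addNr.
Qed.

(** * Additivity of the roots, and the quadratic map Q with its polar form *)

Section GoodEggPolarization.

Variables (F : finFieldType) (L : fieldExtType F) (m : nat).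
Variables (bs cs : 'I_m -> L).

Let g := g_ (F := F) bs cs.
Let h := h_ (F := F) bs cs.
Let qroot := qroot (F := F) (L := L) m.

(** The form in which [exprDn_pchar] wants an exponent. The additive group of [F] is an elementary
    abelian p-group, so its order is a power of p, and [L] has the same characteristic. *)
Lemma pnat_card_pchar k : [pchar L].-nat (#|F| ^ k)%N.
Proof.
have [p p_pr pF] := finPcharP F.
rewrite (eq_pnat _ (pchar_lalg L)).
rewrite pnatX; apply/orP; left.
rewrite (eq_pnat _ (pcharf_eq pF)) -cardsT.
exact: (abelem_pgroup (fin_ring_pchar_abelem pF)).
Qed.

Lemma expf_card_iter (k : F) n : k ^+ (#|F| ^ n) = k.
Proof.
by elim: n => [|n IHn]; rewrite ?expr1 // expnSr exprM IHn expf_card.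
Qed.

(** A power of the q-Frobenius is additive, and it commutes with scalars because it fixes every
    element of [F]. *)
Lemma qroot_linear i (k : F) x y :
  qroot i (k *: x + y) = k *: qroot i x + qroot i y.
Proof.
by rewrite /qroot /Defs.qroot exprDn_pchar ?pnat_card_pchar // exprZn
  expf_card_iter.
Qed.

Lemma qrootD i x y : qroot i (x + y) = qroot i x + qroot i y.
Proof. by have := qroot_linear i 1 x y; rewrite !scale1r. Qed.

Lemma g_linear a b (k : F) x y : g a b (k *: x + y) = k *: g a b x + g a b y.
Proof.
rewrite /g /g_ mulrDr -scalerAr scalerDr scaler_sumr addrACA -big_split /=.
congr (_ + _); apply: eq_bigr => i _.
by rewrite -/qroot qroot_linear mulrDr -scalerAr.
Qed.

Lemma gZ a b (k : F) x : g a b (k *: x) = k *: g a b x.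
Proof.
have g0 : g a b 0 = 0.
  by have := g_linear a b (-1) 0 0; rewrite scaler0 addr0 scaleN1r addNr.
by have := g_linear a b k x 0; rewrite !addr0 g0 addr0.
Qed.

Lemma h_linear a b (k : F) r s r' s' :
  h a b (k *: r + r') (k *: s + s') = k *: h a b r s + h a b r' s'.
Proof.
rewrite /h /h_ mulrDr -scalerAr scalerDr scaler_sumr addrACA -big_split /=.
congr (_ + _); apply: eq_bigr => i _.
rewrite -/qroot -qroot_linear; congr (qroot _ _).
rewrite -[k *: s]mulr_algl -[k *: r]mulr_algl -[k *: (_ + _)]mulr_algl.
ring.
Qed.

Lemma g1E a b :
  g a b 1 = a ^+ 2 + \sum_(i < m) qroot i (bs i * a * b + cs i * b ^+ 2).
Proof.
rewrite /g /g_ mulr1; congr (_ + _); apply: eq_bigr => i _.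
by rewrite -/qroot [X in _ * X]expr1n mulr1.
Qed.

(** Additivity of [qroot] allows the expansion to be done inside each root, where the mixed terms
    are exactly those of h. *)
Lemma g1D a b x y : g (x + a) (y + b) 1 = g x y 1 + h a b x y + g a b 1.
Proof.
rewrite !g1E /h /h_ -/qroot.
have -> : \sum_(i < m) qroot i (bs i * (x + a) * (y + b) + cs i * (y + b) ^+ 2)
  = \sum_(i < m) qroot i (bs i * x * y + cs i * y ^+ 2)
  + \sum_(i < m) qroot i (bs i * (a * y + b * x) + 2%:R * cs i * b * y)
  + \sum_(i < m) qroot i (bs i * a * b + cs i * b ^+ 2).
  rewrite -!big_split; apply: eq_bigr => i _ /=.
  by rewrite -!qrootD; congr (qroot _ _); ring.
ring.
Qed.

Lemma g1N a b : g (- a) (- b) 1 = g a b 1.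
Proof.
rewrite !g1E sqrrN; congr (_ + _); apply: eq_bigr => i _.
by congr (qroot _ _); ring.
Qed.

Lemma g00 : g 0 0 1 = 0.
Proof.
(* A root of 0 is a power of 0, which vanishes only for a nonzero exponent; hence the need for q to
   be nonzero. *)
have F_neq0 : #|F| != 0%N by rewrite -lt0n; apply/card_gt0P; exists 0.
rewrite g1E expr2 mulr0 add0r big1 // => i _.
by rewrite !mulr0 addr0 /qroot /Defs.qroot expr0n expn_eq0 (negPf F_neq0).
Qed.

End GoodEggPolarization.

(** * Coordinates, and membership in the subspaces of the egg *)

Section GoodEggBlocking.

Variables (F : finFieldType) (L : fieldExtType F) (m : nat) (e : m.-tuple L).
Variables (bs cs : 'I_m -> L).
Hypothesis e_basis : basis_of {:L} e.

Local Notation g := (g_ (F := F) bs cs).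
Local Notation h := (h_ (F := F) bs cs).
Local Notation q4 t u r s := (qvec e [tuple t; u; r; s]).

(** Each entry is recovered from its coordinates in the basis [e]. *)
Lemma qvec_inj r : injective (@qvec F L m e r).
Proof.
move=> x y /(can_inj mxvecK)/matrixP eq_xy; apply/eq_from_tnth => k.
rewrite (coord_basis e_basis (memvf (tnth x k))).
rewrite (coord_basis e_basis (memvf (tnth y k))).
by apply: eq_bigr => j _; have := eq_xy k j; rewrite !mxE => ->.
Qed.

Lemma q4_inj t u r s t' u' r' s' :
  q4 t u r s = q4 t' u' r' s' -> [/\ t = t', u = u', r = r' & s = s'].
Proof. by move/qvec_inj/(congr1 val) => [-> -> -> ->]. Qed.

Lemma q4_linear (k : F) t u r s t' u' r' s' :
  q4 (k *: t + t') (k *: u + u') (k *: r + r') (k *: s + s') =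
  k *: q4 t u r s + q4 t' u' r' s'.
Proof.
rewrite /qvec -linearP /=; congr (mxvec _); apply/matrixP => i j.
rewrite !mxE -linearP; congr (coord _ _ _).
by case: i => [[|[|[|[|//]]]] i_lt]; rewrite !(tnth_nth 0).
Qed.

Lemma q4Z (k : F) t u r s :
  k *: q4 t u r s = q4 (k *: t) (k *: u) (k *: r) (k *: s).
Proof.
have q0 : q4 0 0 0 0 = 0.
  by have := q4_linear (-1) 0 0 0 0 0 0 0 0;
    rewrite !scaler0 !addr0 scaleN1r addNr.
by have := q4_linear k t u r s 0 0 0 0; rewrite !addr0 q0 addr0.
Qed.

Lemma q4D t u r s t' u' r' s' :
  q4 t u r s + q4 t' u' r' s' = q4 (t + t') (u + u') (r + r') (s + s').
Proof. by have := q4_linear 1 t u r s t' u' r' s'; rewrite !scale1r. Qed.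

Lemma mem_E a b v : v \in E_ e bs cs a b <->
  exists t, v = q4 t (- g a b t) (- (a * t)) (- (b * t)).
Proof.
apply: (mem_subspace_of (w := q4 0 (- g a b 0) (- (a * 0)) (- (b * 0)))).
  by exists 0.
move=> k _ _ [t ->] [t' ->]; exists (k *: t + t').
rewrite -q4_linear g_linear !mulrDr -!scalerAr.
by rewrite !(opprD (k *: _)) !scalerN.
Qed.

Lemma mem_E_inf v : v \in E_inf e <-> exists t, v = q4 0 t 0 0.
Proof.
apply: (mem_subspace_of (w := q4 0 0 0 0)); first by exists 0.
move=> k _ _ [t ->] [t' ->]; exists (k *: t + t').
by rewrite -q4_linear scaler0 addr0.
Qed.

Lemma mem_Estar a b v : v \in Estar e bs cs a b <->
  exists t r s, v = q4 t (h a b r s + g a b t) r s.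
Proof.
apply: (mem_subspace_of (w := q4 0 (h a b 0 0 + g a b 0) 0 0)).
  by exists 0, 0, 0.
move=> k _ _ [t [r [s ->]]] [t' [r' [s' ->]]].
exists (k *: t + t'), (k *: r + r'), (k *: s + s').
by rewrite -q4_linear h_linear g_linear scalerDr addrACA.
Qed.

Lemma mem_Estar_inf v : v \in Estar_inf e <-> exists t r s, v = q4 0 t r s.
Proof.
apply: (mem_subspace_of (w := q4 0 0 0 0)); first by exists 0, 0, 0.
move=> k _ _ [t [r [s ->]]] [t' [r' [s' ->]]].
exists (k *: t + t'), (k *: r + r'), (k *: s + s').
by rewrite -q4_linear scaler0 addr0.
Qed.

Lemma mem_Gamma' v : v \in Gamma' e <-> exists u : F, exists t r s,
  v = q4 u%:A t r s.
Proof.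
apply: (mem_subspace_of (w := q4 0%:A 0 0 0)); first by exists 0, 0, 0, 0.
move=> k _ _ [u [t [r [s ->]]]] [u' [t' [r' [s' ->]]]].
exists (k * u + u'), (k *: t + t'), (k *: r + r'), (k *: s + s').
by rewrite -q4_linear scalerDl scalerA.
Qed.

Lemma mem_famI a b v : v \in (Estar e bs cs a b :&: Estar_inf e)%VS <->
  exists r s, v = q4 0 (h a b r s) r s.
Proof.
have g0 : g a b 0 = 0 by have := gZ bs cs a b 0 0; rewrite !scale0r.
rewrite memv_cap; split=> [/andP[/mem_Estar[t [r [s ->]]]]|[r [s ->]]].
  case/mem_Estar_inf=> [t' [r' [s' /q4_inj[-> _ _ _]]]]; exists r, s.
  by rewrite g0 addr0.
apply/andP; split; last by apply/mem_Estar_inf; exists (h a b r s), r, s.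
apply/mem_Estar; exists 0, r, s.
by rewrite g0 addr0.
Qed.

(** * The points of the blocking set *)

Definition blockpt a b := q4 1 (- g a b 1) (- a) (- b).

(** Lying in [Gamma'] forces the parameter t of E(a,b) to be a scalar of [F], and by linearity in t
    the vector is that multiple of the one for t = 1. *)
Lemma capE_Gamma' a b : (E_ e bs cs a b :&: Gamma' e = <[blockpt a b]>)%VS.
Proof.
apply/vspaceP => v; rewrite memv_cap; apply/andP/vlineP => [[]|[k ->]].
  case/mem_E=> t -> /mem_Gamma'[u [t' [r [s /q4_inj[-> _ _ _]]]]]; exists u.
  by rewrite /blockpt q4Z gZ -!scalerAr !mulr1 !scalerN.
split; apply: memvZ.
  by apply/mem_E; exists 1; rewrite !mulr1.
by apply/mem_Gamma'; exists 1, (- g a b 1), (- a), (- b); rewrite scale1r.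
Qed.

Lemma blockpt_notin_Estar_inf a b : blockpt a b \notin Estar_inf e.
Proof.
apply/negP=> /mem_Estar_inf[t [r [s /q4_inj[/eqP]]]].
by rewrite oner_eq0.
Qed.

Lemma blockpt_neq0 a b : blockpt a b != 0.
Proof.
by apply: contraNneq (blockpt_notin_Estar_inf a b) => ->; exact: mem0v.
Qed.

Lemma blockBP P : blockB e bs cs P <-> exists a b, P = <[blockpt a b]>%VS.
Proof.
split=> [[E [[[a [b ->]]|-> //] _ ->]]|[a [b ->]]].
  by exists a, b; exact: capE_Gamma'.
exists (E_ e bs cs a b); split; last by rewrite capE_Gamma'.
  by left; exists a, b.
move=> eqE; have : blockpt a b \in E_ e bs cs a b.
  by apply/mem_E; exists 1; rewrite !mulr1.
rewrite eqE => /mem_E_inf[t /q4_inj[/eqP]].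
by rewrite oner_eq0.
Qed.

(** * The members W(a,b,c) of the family *)

Definition famvec a b c (x : (F^o * (L * L))%type) :=
  q4 x.1%:A (x.1 *: c + h a b x.2.1 x.2.2) x.2.1 x.2.2.

Lemma famvec_linear a b c : linear (famvec a b c).
Proof.
move=> k [u [r s]] [u' [r' s']]; rewrite /famvec /= -q4_linear.
rewrite -[k *: u]/(k * u) h_linear; congr (q4 _ _ _ _).
  by rewrite scalerDl scalerA.
by rewrite scalerDl (scalerDr k (u *: c)) -scalerA addrACA.
Qed.

HB.instance Definition _ a b c := GRing.isLinear.Build F
  (F^o * (L * L))%type 'rV[F]_(4 * m) *:%R (famvec a b c)
  (famvec_linear a b c).

Definition famW a b c : {vspace 'rV[F]_(4 * m)} := limg (linfun (famvec a b c)).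

Lemma mem_famW a b c v : v \in famW a b c <-> exists u : F, exists r s,
  v = q4 u%:A (u *: c + h a b r s) r s.
Proof.
split=> [/memv_imgP[[u [r s]] _ ->]|[u [r [s ->]]]].
  by exists u, r, s; rewrite lfunE.
by apply/memv_imgP; exists (u, (r, s)); rewrite ?memvf // lfunE.
Qed.

(** The parametrization is injective, since the first coordinate determines u and the last two are r
    and s; its domain has dimension 1 + m + m over [F]. *)
Lemma dim_famW a b c : \dim (famW a b c) = (2 * m).+1.
Proof.
rewrite /famW limg_dim_eq.
  have dimL : dim L = m by rewrite -dimvf (size_basis e_basis).
  by rewrite dimvf -[LHS]/(1 + (dim L + dim L))%N dimL addnn -mul2n.
apply/eqP; rewrite capfv; apply/lker0P => -[u [r s]] [u' [r' s']].
rewrite !lfunE => /q4_inj[/= /eqP eq_u _ -> ->].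
move: eq_u; rewrite -subr_eq0 -scalerBl scaler_eq0 oner_eq0 orbF subr_eq0.
by move=> /eqP->.
Qed.

Lemma famW_famF a b c : famF e bs cs (famW a b c).
Proof.
split; first exact: dim_famW.
- apply/subvP => v /mem_famW[u [r [s ->]]].
  by apply/mem_Gamma'; exists u, (u *: c + h a b r s), r, s.
- move=> /subvP W_inf.
  have : q4 1%:A (1 *: c + h a b 0 0) 0 0 \in famW a b c.
    by apply/mem_famW; exists 1, 0, 0.
  move/W_inf/mem_Estar_inf=> [t [r [s /q4_inj[/eqP]]]].
  by rewrite scale1r oner_eq0.
exists (Estar e bs cs a b :&: Estar_inf e)%VS; first by exists a, b.
apply/subvP => v /mem_famI[r [s ->]].
by apply/mem_famW; exists 0, r, s; rewrite !scale0r add0r.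
Qed.

(** Inclusion suffices for blocking: a point in the smaller space lies in [W]. A vector of [W]
    outside [Estar_inf], together with the element of I contained in [W], generates some
    W(a,b,c). *)
Lemma famF_famW W : famF e bs cs W -> exists a b c, (famW a b c <= W)%VS.
Proof.
case=> _ /subvP WG W_inf [_ [a [b ->]] /subvP UW].
have [v vW v_inf] : exists2 v, v \in W & v \notin Estar_inf e.
  apply: contra_notP W_inf => noV; apply/subvP => v vW.
  by apply/negPn/negP => v_inf; apply: noV; exists v.
have /mem_Gamma'[u [t [r [s v_def]]]] := WG v vW.
have u_neq0 : u != 0.
  apply: contraNneq v_inf => u0; apply/mem_Estar_inf; exists t, r, s.
  by rewrite v_def u0 scale0r.
(* Subtracting (0,h(r,s),r,s) from [v] clears its last two entries; dividing by u then gives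
   (1,c,0,0). *)
exists a, b, (u^-1 *: (t - h a b r s)).
apply/subvP => _ /mem_famW[k [r' [s' ->]]].
set x := k / u.
have -> : q4 k%:A (k *: (u^-1 *: (t - h a b r s)) + h a b r' s') r' s' =
    x *: v + (- x *: q4 0 (h a b r s) r s + q4 0 (h a b r' s') r' s').
  rewrite v_def !q4Z !q4D !scaler0 !addr0 !scaleNr !addrA !subrr !add0r.
  by rewrite scalerA -/x scalerBr scalerA divfK.
rewrite memvD ?memvZ // memvD ?memvZ //; apply: UW; apply/mem_famI.
  by exists r, s.
by exists r', s'.
Qed.

(** The first coordinate forces u = 1 and the last two give r = -x, s = -y. The remaining equation,
    -Q(x,y) = c + h(-x,-y), becomes the stated one through [g1D] and the evenness of Q. *)
Lemma blockpt_in_famW x y a b c :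
  (blockpt x y \in famW a b c) = (g (a - x) (b - y) 1 + (c - g a b 1) == 0).
Proof.
rewrite [a - x]addrC [b - y]addrC g1D g1N addrA.
apply/idP/eqP => [/mem_famW[u [r [s /q4_inj[u1 eq_g -> ->]]]]|eq0].
  have u1' : u = 1.
    apply/eqP; rewrite -subr_eq0 -(fmorph_eq0 (in_alg L)) rmorphB rmorph1 /=.
    by rewrite -u1 subrr.
  move/eqP: eq_g; rewrite u1' scale1r -subr_eq0 => /eqP eq_g.
  by rewrite -[RHS]oppr0 -eq_g; ring.
apply/mem_famW; exists 1, (- x), (- y); rewrite !scale1r.
congr (q4 _ _ _ _); apply/eqP; rewrite -subr_eq0 -oppr_eq0 -eq0.
by apply/eqP; ring.
Qed.

End GoodEggBlocking.

Theorem theorem4 (F : finFieldType) (L : fieldExtType F) (m : nat)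
    (hm : (1 <= m)%N) (e : m.-tuple L) (he : basis_of {:L} e)
    (bs cs : 'I_m -> L)
    (hegg : egg (eggE e bs cs))
    (hgood : good_at (eggE e bs cs) (E_inf e))
    (htan : forall a b : L,
       tangent_space_at (eggE e bs cs) (E_ e bs cs a b) (Estar e bs cs a b))
    (htan_inf : tangent_space_at (eggE e bs cs) (E_inf e) (Estar_inf e)) :
  minimal_blocking_set (Gamma' e) (Estar_inf e)
    (famF e bs cs) (blockB e bs cs)
  <-> (forall c : L, exists X Y : L,
         X ^+ 2 + \sum_(i < m) qroot m i (bs i * X * Y + cs i * Y ^+ 2) + c
         = 0).
Proof.
split=> [[_ blocks _] c|g_onto].
  (* The term Q(0,0) is added to the constant so that it cancels the one subtracted in
     [blockpt_in_famW]. *)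
  have [P /(blockBP _ _ he)[x [y ->]]] :=
    blocks _ (famW_famF bs cs he 0 0 (c + g_ bs cs 0 0 1)).
  rewrite -memvE (blockpt_in_famW _ _ he) addrK => /eqP g0.
  by exists (0 - x), (0 - y); rewrite -g1E.
have g_eq0 a b : g_ bs cs a b 1 = 0 -> a = 0 /\ b = 0.
  move=> g0; have [[_ _ disj] _] := htan 0 0.
  have pE : blockpt e bs cs a b \in E_ e bs cs a b.
    by apply/(mem_E _ _); exists 1; rewrite !mulr1.
  (* If the two elements coincide, the last two coordinates of the point P(a,b) vanish, so a = b =
     0. Otherwise Q(a,b) = 0 puts P(a,b) in the tangent space E*(0,0), against disjointness. *)
  have [eqE|neqE] := pselect (E_ e bs cs a b = E_ e bs cs 0 0).
    move: pE; rewrite eqE => /mem_E[t /(q4_inj he)[_ _]].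
    by rewrite !mul0r oppr0 => /eqP; rewrite oppr_eq0 => /eqP-> /eqP;
      rewrite oppr_eq0 => /eqP.
  have /vspaceP/(_ (blockpt e bs cs a b)) :=
    disj (E_ e bs cs a b) (or_introl (ex_intro _ a (ex_intro _ b erefl))) neqE.
  rewrite memv_cap pE memv0 (negPf (blockpt_neq0 _ _ he _ _)) => /negP[].
  apply/mem_Estar; exists 1, (- a), (- b).
  congr (qvec _ [tuple _; _; _; _]); rewrite g0 oppr0.
  (* Polarization at the base point (0,0) shows h(-a,-b) + Q(0,0) = 0 without unfolding h. *)
  apply: (addrI (g_ bs cs (- a) (- b) 1)).
  by rewrite addr0 addrA -g1D !addr0.
split=> [_ /(blockBP _ _ he)[x [y ->]]|W WF|_ /(blockBP _ _ he)[x [y ->]]].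
- split; first by rewrite dim_vline blockpt_neq0.
    by rewrite -capE_Gamma' // capvSr.
  by rewrite -memvE; apply/negP/blockpt_notin_Estar_inf.
- have [a [b [c W_sub]]] := famF_famW he WF.
  (* The zero (X,Y) plays the role of (a-x,b-y) in the incidence condition, so the blocking point
     has parameters (a-X,b-Y). *)
  have [X [Y XY0]] := g_onto (c - g_ bs cs a b 1).
  exists <[blockpt e bs cs (a - X) (b - Y)]>%VS.
    by apply/blockBP => //; exists (a - X), (b - Y).
  apply: subv_trans W_sub; rewrite -memvE blockpt_in_famW // !subKr.
  by rewrite g1E XY0.
exists (famW e bs cs x y (g_ bs cs x y 1)); split; first exact: famW_famF.
  by rewrite -memvE blockpt_in_famW // !subrr g00 addr0.
move=> _ /(blockBP _ _ he)[x' [y' ->]].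
rewrite -memvE blockpt_in_famW // subrr addr0 => /eqP/g_eq0[/eqP + /eqP].
by rewrite !subr_eq0 => /eqP-> /eqP->.
Qed.
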